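(* By re-ordering, any left cancellative $k$-translatable semigroup can be transformed into a left unitary $k$-translatable semigroup. That is, if $Q$ is a left cancellative semigroup of order $n$ which is $k$-translatable with respect to some ordering of its elements, then there is an ordering $b_1,b_2,\ldots,b_n$ of the elements of $Q$ such that $b_1$ is a left neutral element of $Q$ and $Q$ is $k$-translatable with respect to the ordering $b_1,b_2,\ldots,b_n$.
   Context: A groupoid is a set with a binary operation $\cdot$; a semigroup is an associative groupoid. It is left cancellative if $x\cdot y=x\cdot z$ implies $y=z$. An element $e$ is left neutral if $e\cdot x=x$ for all $x$. For an integer $x$, $[x]_n$ denotes the residue of $x$ modulo $n$, represented in $\{1,\ldots,n\}$, with $0$ identified with $n$. For $1\le k<n$, a groupoid $Q$ of order $n$ is $k$-translatable with respect to an ordering $q_1,\ldots,q_n$ of its elements if in its multiplication table (rows and columns listed in this order) each row is obtained from the preceding one by cyclically shifting it $k$ places to the right, i.e. $q_i\cdot q_j=q_{i-1}\cdot q_{[j-k]_n}$ for all $j$ and all $2\le i\le n$. A groupoid is left unitary (with respect to an ordering) if the first element of the ordering is a left neutral element. *)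

(* Defs.v *)
From mathcomp Require Import all_boot.

Set Implicit Arguments.
Unset Strict Implicit.
Unset Printing Implicit Defensive.

Local Open Scope group_scope.

(* An ordering q_1, ..., q_n of Q is a bijection q : 'I_n -> Q, with q_i stored
   at index i - 1.  A bijection makes Q a set of order n. *)
Definition ordering (Q : Type) (n : nat) (q : 'I_n -> Q) : Prop := bijective q.

(* The 0-based form of [j - k]_n, for k <= n: subtracting 1 from the residue of
   (j + 1) - k taken in {1, ..., n} gives the residue of j - k in
   {0, ..., n - 1}.  The subtraction of k is done as the addition of n - k. *)
Definition subk_mod (n k : nat) (j : 'I_n) : 'I_n :=
  Ordinal (ltn_pmod (j + (n - k)) (leq_ltn_trans (leq0n j) (ltn_ord j))).

(* i' is the row preceding i; the first row has none. *)
Definition translatable (Q : magmaType) (n k : nat) (q : 'I_n -> Q) : Prop :=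
  (0 < k < n)%N /\
  forall i i' j : 'I_n, i = i'.+1 :> nat -> q i * q j = q i' * q (subk_mod k j).

(* ssrfun's right_injective is injectivity in the right argument, that is,
   cancellation on the left. *)
Definition left_cancellative (Q : magmaType) : Prop :=
  @right_injective Q Q Q *%g.

Definition left_neutral (Q : magmaType) (e : Q) : Prop := @left_id Q Q e *%g.

Definition left_unitary (Q : magmaType) (n : nat) (q : 'I_n -> Q) : Prop :=
  exists2 i : 'I_n, i = 0%N :> nat & left_neutral (q i).

(* Main.v *)
Require Import Defs.
From mathcomp Require Import all_boot.
From mathcomp Require Import all_algebra.
From mathcomp Require Import ring.

(** Index the ordering from 0, by residues modulo n.  Translatability says that
    [a i * a j] depends only on [j - i k], so that
    [a i * a j = a 0 * a (j - i k)] ([translatable_mulE]).  Write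
    [a 0 * a 0 = a c].  Associativity of [a 0 * a 0 * a j], with [a 0] cancelled
    on the left, shows that [a 0] acts on indices as the rotation by [- c k];
    at [j = 0] this rotation takes 0 to [c], whence [c = - c k].  The whole
    table is thus affine, [a i * a j = a (j - i k + c)]
    ([cancel_translatable_affine]), and [a (- c)] is left neutral.  Starting the
    cyclic ordering there, [b i = a (i - c)], removes the constant: the relation
    [c + c k = 0] turns the product into [b i * b j = b (j - i k)], which is
    translatable with [b 0] neutral. *)

Set Implicit Arguments.
Unset Strict Implicit.
Unset Printing Implicit Defensive.

Import GRing.Theory.
Local Open Scope ring_scope.

(** A translatable ordering has length at least 2, because 0 < k < n, so nothing
    is lost in writing the length as m.+2, for which 'I_m.+2 is the ring of
    residues. *)
Lemma subk_modE (m k : nat) (j : 'I_m.+2) :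
  (k < m.+2)%N -> subk_mod k j = j - k%:R.
Proof.
move=> lt_k; apply: val_inj => /=.
by rewrite Zp_nat /= modnDmr (modn_small lt_k).
Qed.

Lemma ord_succE (m : nat) (i i' : 'I_m.+2) : i = i'.+1 :> nat -> i = i' + 1.
Proof. by move=> def_i; rewrite -[i]natr_Zp def_i -natr1 natr_Zp. Qed.

Lemma translatable_mulE (Q : magmaType) (m k : nat) (q : 'I_m.+2 -> Q) :
  translatable k q ->
  forall i j, (q i * q j = q 0%R * q (j - i * k%:R)%R)%g.
Proof.
case=> /andP[_ lt_k] shift_q [i lt_i].
elim: i lt_i => [|i IHi] lt_i j.
  have ->: Ordinal lt_i = 0 by apply: val_inj.
  by rewrite mul0r subr0.
rewrite (shift_q (Ordinal lt_i) (Ordinal (ltnW lt_i)) j erefl) IHi subk_modE //.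
have -> : Ordinal lt_i = Ordinal (ltnW lt_i) + 1 by apply: ord_succE.
by congr (_ * q _)%g; ring.
Qed.

(** A factorisation of the table through [j - i k] is preserved by passing from
    row [i] to the next while moving [k] places, which is translatability. *)
Lemma mulE_translatable (Q : magmaType) (m k : nat) (q f : 'I_m.+2 -> Q) :
    (0 < k < m.+2)%N ->
    (forall i j, (q i * q j)%g = f (j - i * k%:R)) ->
  translatable k q.
Proof.
move=> k_bounds q_mul; split=> // i i' j /ord_succE ->.
case/andP: k_bounds => _ lt_k.
by rewrite !q_mul subk_modE //; congr f; ring.
Qed.

(** Compute [a 0 * a 0 * a j] in two ways: as row [c] of the table, which
    translatability reduces to [a 0 * a (j - c k)], and as [a 0 * (a 0 * a j)].
    Cancelling [a 0] makes the first row a rotation, and the rotation amount is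
    tied to [c] because that row starts with [a c]. *)
Lemma cancel_translatable_affine (Q : semigroupType) (m k : nat)
    (a : 'I_m.+2 -> Q) :
    ordering a -> left_cancellative Q -> translatable k a ->
  exists2 c : 'I_m.+2, c + c * k%:R = 0
    & forall i j, (a i * a j)%g = a (j - i * k%:R + c).
Proof.
case=> index indexK aK Q_cancel /translatable_mulE a_mul.
pose c := index (a 0%R * a 0%R)%g.
have a_c : a c = (a 0%R * a 0%R)%g by apply: aK.
have first_row j : (a 0%R * a j)%g = a (j - c * k%:R).
  by apply: (Q_cancel (a 0)); rewrite mulgA -a_c (a_mul c).
have def_c : c = - (c * k%:R).
  by apply: (can_inj indexK); rewrite a_c first_row sub0r.
exists c => [|i j]; first by rewrite {1}def_c addNr.
by rewrite a_mul first_row -def_c.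
Qed.

Theorem theorem5p6 (Q : semigroupType) (n k : nat) (a : 'I_n -> Q)
    (a_ordering : ordering a)
    (Q_cancel : left_cancellative Q)
    (a_translatable : translatable k a) :
  exists b : 'I_n -> Q, [/\ ordering b, left_unitary b & translatable k b].
Proof.
have [k_bounds _] := a_translatable.
have /andP[k_gt0 lt_k] := k_bounds.
case: n => [|[|m]] in a a_ordering a_translatable k_bounds lt_k *.
- by [].
- by case: k k_gt0 lt_k {a_translatable k_bounds}.
have [c c_rel a_mul] :=
  cancel_translatable_affine a_ordering Q_cancel a_translatable.
pose b (i : 'I_m.+2) := a (i - c).
have b_ordering : ordering b.
  by apply: (bij_comp a_ordering); exists (+%R^~ c); [exact: subrK | exact: addrK].
have b_mul i j : (b i * b j)%g = b (j - i * k%:R).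
  rewrite a_mul; congr a.
  by rewrite -[RHS]addr0 -c_rel; ring.
exists b; split=> //; last exact: mulE_translatable k_bounds b_mul.
exists 0 => // x; have [index _ bK] := b_ordering.
by rewrite -(bK x) b_mul mul0r subr0.
Qed.
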